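(* Let $\mathcal{T}(\mathcal{N})$ be a continuous nest algebra associated to a nest $\mathcal{N}$ of projections on a complex Hilbert space $\mathfrak{H}$, let $\mathfrak{L}$ be a norm closed Lie ideal of $\mathcal{T}(\mathcal{N})$, and let $P\mapsto P'$ be the left order continuous homomorphism on $\mathcal{N}$ defined, for all $P\in\mathcal{N}$, by $$P'=\bigvee\{P_y\in\mathcal{N} : x\otimes y\in\mathfrak{L} \text{ and } \hat{P}_x<P\}.$$ Then a finite rank operator $T$ in $\mathcal{T}(\mathcal{N})$ lies in $\mathfrak{L}$ if and only if, for all projections $P$ in $\mathcal{N}$, $$(P')^{\perp}\,T\,P=0.$$
   Context: $\mathfrak{H}$ is a complex Hilbert space with inner product $\langle\cdot,\cdot\rangle$ (linear in the first variable), and $\mathcal{B}(\mathfrak{H})$ is the algebra of bounded linear operators on $\mathfrak{H}$. Projections are orthogonal projections, ordered as usual, and $P^\perp=I-P$. A nest $\mathcal{N}$ is a totally ordered family of projections in $\mathcal{B}(\mathfrak{H})$ containing $0$ and $I$; throughout, nests are complete, i.e. $\mathcal{N}$ is a complete sublattice of the lattice of projections in $\mathcal{B}(\mathfrak{H})$. For $P\in\mathcal{N}$, $P_-=\bigvee\{Q\in\mathcal{N}:Q<P\}$ if $P\neq0$, and $0_-=0$. A complete nest is continuous if $P_-=P$ for all $P\in\mathcal{N}$. The nest algebra is $\mathcal{T}(\mathcal{N})=\{T\in\mathcal{B}(\mathfrak{H}): P^\perp TP=0 \text{ for all } P\in\mathcal{N}\}$; it is called a continuous nest algebra if $\mathcal{N}$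 is continuous. A Lie ideal of $\mathcal{T}(\mathcal{N})$ is a complex subspace $\mathfrak{L}\subseteq\mathcal{T}(\mathcal{N})$ with $[\mathfrak{L},\mathcal{T}(\mathcal{N})]\subseteq\mathfrak{L}$, where $[T,S]=TS-ST$. For $x,y\in\mathfrak{H}$, $x\otimes y$ is the operator $z\mapsto\langle z,x\rangle y$. For $z\in\mathfrak{H}$, $P_z=\bigwedge\{Q\in\mathcal{N}:Qz=z\}$ and $\hat{P}_z=\bigvee\{Q\in\mathcal{N}:Qz=0\}$. A homomorphism on $\mathcal{N}$ is a map $\varphi:\mathcal{N}\to\mathcal{N}$ such that $P\le Q$ implies $\varphi(P)\le\varphi(Q)$; it is left order continuous if $\varphi(\bigvee\mathcal{M})=\bigvee\varphi(\mathcal{M})$ for all subsets $\mathcal{M}$ of $\mathcal{N}$. *)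

(* Defs.v *)
From HB Require Import structures.
From mathcomp Require Import all_boot all_order all_algebra sesquilinear.
From mathcomp Require Import complex.
From mathcomp Require Import boolp classical_sets functions reals topology normedtype.

Set Implicit Arguments.
Unset Strict Implicit.
Unset Printing Implicit Defensive.

Import Order.TTheory GRing.Theory Num.Theory.
Import numFieldNormedType.Exports.

Local Open Scope classical_set_scope.
Local Open Scope ring_scope.
Local Open Scope complex_scope.

(* Complex Hilbert spaces.  [{dot H for conjC}] is the type of positive
   definite Hermitian forms that are linear in the first variable. *)
HB.mixin Record CompleteNormedModule_isHilbert (R : realType) H
    & CompleteNormedModule R[i] H := {
  inner : {dot H for (@Num.conj R[i])} ;
  norm_innerE : forall x : H, `|x| ^+ 2 = inner x x
}.

#[short(type="hilbertType")]
HB.structure Definition Hilbert (R : realType) :=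
  {H of CompleteNormedModule R[i] H & CompleteNormedModule_isHilbert R H}.

Section Operators.
Context {R : realType} {H : hilbertType R}.
Implicit Types (P Q T S : H -> H) (A N L : set (H -> H)) (x y z : H).

Definition bounded_operator T : Prop :=
  linear T /\ exists M : R, forall x, `|T x| <= M%:C * `|x|.

(* The norm of [H] takes its values in the nonnegative reals of [R[i]],
   hence the real part. *)
Definition opnorm T : R :=
  sup [set complex.Re `|T x| | x in [set x : H | `|x| <= 1]].

Definition rank_one x y : H -> H := fun z => inner z x *: y.

Definition finite_rank T : Prop :=
  exists (n : nat) (e : 'I_n -> H), forall x,
    exists c : 'I_n -> R[i], T x = \sum_(i < n) c i *: e i.

Definition projection P : Prop :=
  [/\ bounded_operator P, P \o P = P &
      forall x y, inner (P x) y = inner x (P y)].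

Definition perp P : H -> H := idfun - P.

Definition proj_le P Q : Prop := Q \o P = P.

Definition proj_lt P Q : Prop := proj_le P Q /\ P <> Q.

Definition is_join A P : Prop :=
  [/\ projection P, forall Q, A Q -> proj_le Q P &
      forall Q, projection Q -> (forall S, A S -> proj_le S Q) -> proj_le P Q].

Definition is_meet A P : Prop :=
  [/\ projection P, forall Q, A Q -> proj_le P Q &
      forall Q, projection Q -> (forall S, A S -> proj_le Q S) -> proj_le Q P].

(* Joins and meets are taken in the lattice of all projections of [H]; the
   default value [0] is irrelevant for subsets of a complete nest. *)
Definition join A : H -> H := xget 0 (is_join A).

Definition meet A : H -> H := xget 0 (is_meet A).

Definition complete_nest N : Prop :=
  [/\ N `<=` projection,
      forall P Q, N P -> N Q -> proj_le P Q \/ proj_le Q P,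
      N 0 /\ N idfun &
      forall A, A `<=` N ->
        (exists2 P, N P & is_join A P) /\ (exists2 P, N P & is_meet A P)].

Definition nest_pred N P : H -> H :=
  if `[< P = 0 >] then 0 else join [set Q | N Q /\ proj_lt Q P].

Definition continuous_nest N : Prop :=
  complete_nest N /\ forall P, N P -> nest_pred N P = P.

Definition nest_algebra N : set (H -> H) :=
  [set T | bounded_operator T /\ forall P, N P -> perp P \o T \o P = 0].

Definition commutator T S : H -> H := (T \o S) - (S \o T).

Definition lie_ideal N L : Prop :=
  [/\ L `<=` nest_algebra N,
      L 0,
      forall T S, L T -> L S -> L (T + S),
      forall (a : R[i]) T, L T -> L (a *: T) &
      forall T S, L T -> nest_algebra N S -> L (commutator T S)].

Definition norm_closed L : Prop :=
  forall T, bounded_operator T ->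
    (forall e : R, 0 < e -> exists2 S, L S & opnorm (T - S) < e) -> L T.

Definition vec_proj N z : H -> H := meet [set Q | N Q /\ Q z = z].

Definition vec_hat N z : H -> H := join [set Q | N Q /\ Q z = 0].

Definition left_order_continuous_hom N (phi : (H -> H) -> (H -> H)) : Prop :=
  [/\ forall P, N P -> N (phi P),
      forall P Q, N P -> N Q -> proj_le P Q -> proj_le (phi P) (phi Q) &
      forall A, A `<=` N -> phi (join A) = join (phi @` A)].

(* The map P |-> P' of the nest into itself attached to [L]. *)
Definition lie_hom N L P : H -> H :=
  join [set Q | exists x y,
    [/\ Q = vec_proj N y, L (rank_one x y) & proj_lt (vec_hat N x) P]].

End Operators.

(* Main.v *)
Require Import Defs.
From mathcomp Require Import all_boot all_order all_algebra sesquilinear complex.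
From mathcomp Require Import boolp classical_sets functions reals topology normedtype.
From mathcomp Require Import ring lra.

(** Write [P'] for [lie_hom N L P].  Left order continuity of [P |-> P'] is
formal: [P'] is a join over the pairs [(x, y)] such that [vec_hat N x < P], and
in a totally ordered family a projection lies strictly below a join if and only
if it lies strictly below one of the members.  The rest compares [L] with the
bimodule of the operators mapping the range of [P] into the range of [P'] for
every [P] of the nest.

A finite rank [T] of [L] belongs to the bimodule.  As the nest is continuous, it
is enough to show that [T b] is in the range of [P'] when [b] is in the range of
some [Q < P].  The gap between [Q] and [P] is infinite dimensional
([orthogonal_in_gap]), so it contains a vector [a != 0] orthogonal to the range
of [T].  Then [rank_one a b] is in the nest algebra, and its commutator with [T]
is exactly [rank_one a (T b)], the other term being killed by the choice of [a].
Hence [rank_one a (T b)] is in [L], while [P a != 0]; the definition of [P']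
gives the claim.

Conversely, a rank one operator [rank_one x y] of the bimodule is in [L]
([lie_rank_one_mem]).  Commutators turn any [rank_one z w] of [L] with
[P z != 0] into [rank_one a w] for every [a] killed by [P], and then into
[rank_one a (Q y)] for every [y] and every [Q] of the nest below
[vec_proj N w].  Continuity of the nest and norm closedness of [L] reach
[rank_one x y]: [y] is a limit of vectors [vec_proj N w y], because [P'] is the
strong limit of the chain of which it is the join, and [x] is the limit of
[x - P x] as [P] decreases to [vec_hat N x].

Finally, an operator [T] of the bimodule with finite rank is a sum of rank one
operators of the bimodule, by induction on the number of vectors that span its
range ([lie_finite_rank_mem]).  The nonzero subspaces among the [T P H], for [P]
in the nest, form a chain of finite dimensional spaces, so they share a vector
[w != 0] ([chain_common_vector]), which lies in the range of [P'] whenever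
[T P != 0].  The part of [T] along [w] is then a rank one operator of the
bimodule, and the part orthogonal to [w] has a range spanned by one vector
less.

The Hilbert space theory underneath is the projection theorem for closed
subspaces, with the Riesz representation of bounded functionals (used to write
the part of [T] along [w] as some [rank_one u w]), and the fact that a join of a
chain of projections is its strong limit ([join_approx]). *)

Set Implicit Arguments.
Unset Strict Implicit.
Unset Printing Implicit Defensive.

Import Order.TTheory GRing.Theory Num.Theory.
Import numFieldNormedType.Exports.

Local Open Scope classical_set_scope.
Local Open Scope ring_scope.
Local Open Scope complex_scope.

Section LieIdealsOfNestAlgebras.
Context {R : realType} {H : hilbertType R}.
Implicit Types (x y z : H) (c e : R[i]) (P Q S T : H -> H) (A N L : set (H -> H)).

(** * Inner product and completeness *)

Lemma innerC x y : inner y x = (inner x y)^*%C.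
Proof. by rewrite hermC expr0 mul1r. Qed.

Lemma innerDl x y z : inner (x + y) z = inner x z + inner y z.
Proof. exact: linearDl. Qed.

Lemma innerDr x y z : inner x (y + z) = inner x y + inner x z.
Proof. exact: linearDr. Qed.

Lemma innerBl x y z : inner (x - y) z = inner x z - inner y z.
Proof. exact: linearBl. Qed.

Lemma innerBr x y z : inner x (y - z) = inner x y - inner x z.
Proof. exact: linearBr. Qed.

Lemma innerZl c x y : inner (c *: x) y = c * inner x y.
Proof. exact: linearZl_LR. Qed.

Lemma innerZr c x y : inner x (c *: y) = c^*%C * inner x y.
Proof. exact: linearZr_LR. Qed.

Lemma inner0l x : inner 0 x = 0.
Proof. exact: linear0l. Qed.

Lemma inner0r x : inner x 0 = 0.
Proof. exact: linear0r. Qed.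

Lemma inner_suml n (v : 'I_n -> H) z :
  inner (\sum_i v i) z = \sum_i inner (v i) z.
Proof.
by rewrite (big_morph (fun u => inner u z) (fun x y => innerDl x y z) (inner0l z)).
Qed.

Lemma inner_eq0 x : inner x x = 0 -> x = 0.
Proof. by rewrite -norm_innerE => /eqP; rewrite expf_eq0 /= normr_eq0 => /eqP. Qed.

Lemma inner_sym0 x y : inner x y = 0 -> inner y x = 0.
Proof. by move=> h; rewrite innerC h conjc0. Qed.

Lemma sqr_normD x y :
  `|x + y| ^+ 2 = `|x| ^+ 2 + inner x y + inner y x + `|y| ^+ 2.
Proof. by rewrite !norm_innerE innerDl !innerDr !addrA. Qed.

Lemma sqr_normB x y :
  `|x - y| ^+ 2 = `|x| ^+ 2 - inner x y - inner y x + `|y| ^+ 2.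
Proof. by rewrite !norm_innerE innerBl !innerBr opprB addrA addrAC. Qed.

Lemma parallelogram x y :
  `|x - y| ^+ 2 = `|x| ^+ 2 *+ 2 + `|y| ^+ 2 *+ 2 - `|x + y| ^+ 2.
Proof. rewrite sqr_normB sqr_normD; ring. Qed.

(** The residue of [x] after projecting it on the line of [y]; its positivity is
the Cauchy-Schwarz inequality. *)
Lemma sqr_norm_reject x y : y != 0 ->
  `|x - (inner x y / `|y| ^+ 2) *: y| ^+ 2 =
  `|x| ^+ 2 - `|inner x y| ^+ 2 / `|y| ^+ 2.
Proof.
move=> y0.
have yC : (`|y| ^+ 2)^*%C = `|y| ^+ 2 :> R[i].
  by rewrite norm_innerE -innerC.
rewrite sqr_normB innerZl innerZr normrZ exprMn.
have -> : `|inner x y / `|y| ^+ 2| ^+ 2 = `|inner x y| ^+ 2 / `|y| ^+ 4.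
  by rewrite normf_div normrX normr_id expr_div_n -exprM.
rewrite sqr_normc rmorphM /= conjc_inv yC [inner y x]innerC.
have : `|y| != 0 by rewrite normr_eq0.
by move=> ?; field.
Qed.

Lemma norm_cauchy_schwarz x y : `|inner x y| <= `|x| * `|y|.
Proof.
have [->|y0] := eqVneq y 0; first by rewrite inner0r normr0 mulr_ge0.
rewrite -(@ler_pXn2r _ 2) ?nnegrE ?mulr_ge0//.
have := exprn_ge0 2 (normr_ge0 (x - (inner x y / `|y| ^+ 2) *: y)).
rewrite sqr_norm_reject// subr_ge0 ler_pdivrMr ?exprn_gt0 ?normr_gt0//.
by rewrite exprMn.
Qed.

(** The norm of [H] is a real number inside [R[i]]; infima and square roots are
taken in [R], so these lemmas move between the two. *)
Lemma normRe x : (complex.Re `|x|)%:C = `|x|.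
Proof. by rewrite RRe_real// normr_real. Qed.

Lemma pos_real_complex e : 0 < e -> exists2 r : R, 0 < r & e = r%:C.
Proof.
move=> e0; exists (complex.Re e); last by rewrite RRe_real// gtr0_real.
by move: e0; rewrite ltcE /= => /andP[].
Qed.

Lemma cauchy_seq_limit (k : nat -> H) :
    (forall e, 0 < e -> exists n0, forall m n, (n0 <= m)%N -> (n0 <= n)%N ->
       `|k m - k n| < e) ->
  exists p, forall e, 0 < e -> exists n0, forall n, (n0 <= n)%N ->
    `|p - k n| < e.
Proof.
move=> kC.
have /cauchy_cvgP : cauchy (k @ \oo).
  apply/cauchy_ballP => e e0.
  have [n0 hn0] := kC _ e0.
  exists ([set z | exists2 n, (n0 <= n)%N & z = k n],
          [set z | exists2 n, (n0 <= n)%N & z = k n]).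
    by split; exists n0 => // n /= hn; exists n.
  by move=> [a b] /= [[m hm ->] [n hn ->]]; rewrite -ball_normE /=; exact: hn0.
move=> /cvgrPdist_lt h; exists (lim (k @ \oo)) => e e0.
by have [n0 _ hn] := h _ e0; exists n0 => n n0n; exact: hn.
Qed.

(** * Orthogonal projections onto closed subspaces *)

Definition approximable (K : set H) y : Prop :=
  forall e, 0 < e -> exists2 k, K k & `|y - k| < e.

Definition closed_subspace (K : set H) : Prop :=
  [/\ K 0, forall c x y, K x -> K y -> K (c *: x + y) &
      forall y, approximable K y -> K y].

Lemma invS_eventually_lt (r : R) : 0 < r ->
  exists n0, forall n, (n0 <= n)%N -> n.+1%:R^-1 < r.
Proof.
move=> r0; have r1 : 0 <= r^-1 by rewrite invr_ge0 ltW.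
have h := archi_boundP r1.
exists (Num.bound r^-1) => n hn; rewrite invf_plt ?posrE//.
by apply: (lt_le_trans h); rewrite ler_nat ltnW.
Qed.

Lemma normRe_ge0 x : 0 <= complex.Re `|x|.
Proof. by rewrite -ler0c normRe. Qed.

Lemma sqr_norm_lt_real x (r : R) : 0 < r ->
  complex.Re (`|x| ^+ 2) < r ^+ 2 -> `|x| < r%:C.
Proof.
move=> r0; rewrite -normRe -(rmorphXn (real_complex R)) /= ltcR => h.
by rewrite -(@ltr_pXn2r _ 2)// nnegrE ?normRe_ge0// ltW.
Qed.

Lemma sqr_normRe x : (complex.Re (`|x| ^+ 2))%:C = `|x| ^+ 2.
Proof. by rewrite RRe_real// realX// normr_real. Qed.

(** A minimizing sequence is Cauchy by the parallelogram identity, since the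
midpoint of two of its terms stays in [K]. *)
Lemma nearest_point (K : set H) y : closed_subspace K ->
  exists2 p, K p & forall k, K k -> `|y - p| <= `|y - k|.
Proof.
move=> [K0 KD Kcl].
pose D k : R := complex.Re (`|y - k| ^+ 2).
have D0 k : 0 <= D k by rewrite -ler0c sqr_normRe exprn_ge0.
have Dinf : has_inf [set D k | k in K].
  by split; [exists (D 0), 0|exists 0 => _ [k _ <-]].
pose d := inf [set D k | k in K].
have dle k : K k -> d <= D k by move=> Kk; apply: ge_inf; [exact: Dinf.2|exists k].
have d0 : 0 <= d.
  by apply: lb_le_inf; [exact: Dinf.1|move=> _ [k _ <-]].
have /choice[k hk] : forall n, exists k, K k /\ D k < d + n.+1%:R^-1.
  move=> n; have [|_ [k Kk <-] hk] := @inf_adherent _ _ n.+1%:R^-1 _ Dinf.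
    by rewrite invr_gt0.
  by exists k.
have kK n : K (k n) by case: (hk n).
have kD n : D (k n) < d + n.+1%:R^-1 by case: (hk n).
have dist m n : complex.Re (`|k m - k n| ^+ 2) <= 2 * m.+1%:R^-1 + 2 * n.+1%:R^-1.
  have -> : k m - k n = (y - k n) - (y - k m) by rewrite opprB [RHS]addrC addrA subrK.
  have Kmid : K (2^-1 *: k m + 2^-1 *: k n).
    by apply: (KD) => //; rewrite -[_ *: _]addr0; apply: (KD).
  have /dle := Kmid.
  have h : `|y - k n + (y - k m)| ^+ 2 =
      4 * `|y - (2^-1 *: k m + 2^-1 *: k n)| ^+ 2.
    have -> : y - k n + (y - k m) = 2 *: (y - (2^-1 *: k m + 2^-1 *: k n)).
      rewrite scalerBr scalerDr !scalerA divff ?pnatr_eq0// !scale1r scaler_nat.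
      by rewrite mulr2n addrACA -opprD [k n + _]addrC.
    by rewrite normrZ exprMn normr_nat -natrX.
  have -> : complex.Re (`|(y - k n) - (y - k m)| ^+ 2) =
      2 * D (k n) + 2 * D (k m) - 4 * D (2^-1 *: k m + 2^-1 *: k n).
    apply: complexI; rewrite rmorphB rmorphD /= !rmorphM /= !sqr_normRe.
    by rewrite parallelogram h; ring.
  move: (kD n) (kD m); move: (D _) (D _) (D _) n.+1%:R^-1 m.+1%:R^-1.
  by move=> *; lra.
have /cauchy_seq_limit[p hp] : forall e, 0 < e -> exists n0, forall m n,
    (n0 <= m)%N -> (n0 <= n)%N -> `|k m - k n| < e.
  move=> _ /pos_real_complex[r r0 ->].
  have [n0 hn0] : exists n0, forall n, (n0 <= n)%N -> n.+1%:R^-1 < r ^+ 2 / 4.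
    by apply: invS_eventually_lt; rewrite divr_gt0// exprn_gt0.
  exists n0 => m n /hn0 hm /hn0 hn; apply: sqr_norm_lt_real => //.
  apply: le_lt_trans (dist m n) _.
  move: hm hn; set u := m.+1%:R^-1; set v := n.+1%:R^-1; move: u v => u v;
  by clear -r0 => hm hn; lra.
(* The limit [p] is a minimizer: if its distance [s] to [y] exceeded
   [t = sqrt d], a late term of the sequence would lie within [(s - t) / 2] of
   [p], hence too far from [y]. *)
exists p; first by apply: Kcl => e /hp[n0 /(_ _ (leqnn _)) h]; exists (k n0).
move=> q Kq; rewrite -(normRe (y - p)) -(normRe (y - q)) lecR.
set s := complex.Re `|y - p|.
have DE z : D z = (complex.Re `|y - z|) ^+ 2.
  by apply: complexI; rewrite sqr_normRe rmorphXn /= normRe.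
rewrite -(@ler_pXn2r _ 2) ?nnegrE ?normRe_ge0// -[leRHS]DE.
apply: (le_trans _ (dle _ Kq)); rewrite leNgt; apply/negP => ds.
have t0 := sqrtr_ge0 d; have t2 := sqr_sqrtr d0.
set t := Num.sqrt d in t0 t2.
have ts : t < s by rewrite -(@ltr_pXn2r _ 2)// ?nnegrE ?normRe_ge0// t2.
pose r := (s - t) / 2.
have r0 : 0 < r by rewrite /r divr_gt0// subr_gt0.
have [n1 hn1] : exists n0, forall n, (n0 <= n)%N -> n.+1%:R^-1 < r ^+ 2.
  by apply: invS_eventually_lt; rewrite exprn_gt0.
have [|n2 hn2] := hp r%:C; first by rewrite ltcR.
pose n := maxn n1 n2.
have := hn2 n (leq_maxr _ _); rewrite -normRe ltcR => hb.
have := kD n; rewrite DE => hD.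
have hn := hn1 n (leq_maxl _ _).
have : s <= complex.Re `|y - k n| + complex.Re `|p - k n|.
  rewrite -lecR rmorphD /= !normRe.
  by rewrite -[y - p](subrKA (k n)) (le_trans (ler_normD _ _))// lerD2l distrC.
have := normRe_ge0 (y - k n).
set a := complex.Re `|y - k n| in hD *; set b := complex.Re `|p - k n| in hb *.
move=> a0 sab.
have ha : (t + r) ^+ 2 < a ^+ 2.
  rewrite ltr_pXn2r// ?nnegrE ?addr_ge0// ?ltW//.
  by move: sab hb; rewrite /r; clear; lra.
have := mulr_ge0 t0 (ltW r0).
move: ha hD hn t2; set v := n.+1%:R^-1; move: v => v; rewrite sqrrD.
by clear => ha hD hn t2 tr; lra.
Qed.

(** If [y - p] were not orthogonal to [k], subtracting its component along [k]
would bring [p] closer to [y]. *)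
Lemma orthogonal_projection_point (K : set H) y : closed_subspace K ->
  exists2 p, K p & forall k, K k -> inner (y - p) k = 0.
Proof.
move=> Ksub; have [p Kp hp] := nearest_point y Ksub; exists p => // k Kk.
have [->|k0] := eqVneq k 0; first by rewrite inner0r.
have [_ KD _] := Ksub.
have := hp _ (KD (inner (y - p) k / `|k| ^+ 2) _ _ Kk Kp).
rewrite [_ *: k + p]addrC opprD addrA -(@ler_pXn2r _ 2) ?nnegrE// sqr_norm_reject//.
rewrite lerBrDl gerDr pmulr_lle0 ?invr_gt0 ?exprn_gt0 ?normr_gt0// => h.
have /eqP : `|inner (y - p) k| ^+ 2 = 0 by apply/le_anti; rewrite h exprn_ge0.
by rewrite expf_eq0 /= normr_eq0 => /eqP.
Qed.

Lemma projection_onto (K : set H) : closed_subspace K ->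
  exists2 E : H -> H, projection E & (forall y, K (E y)) /\ forall y, K y -> E y = y.
Proof.
move=> Ksub; have [K0 KD _] := Ksub.
have /choice[E hE] : forall y, exists p, K p /\ forall k, K k -> inner (y - p) k = 0.
  by move=> y; have [p] := orthogonal_projection_point y Ksub; exists p.
have KE y : K (E y) by case: (hE y).
have Eo y k : K k -> inner (y - E y) k = 0 by case: (hE y) => _; apply.
have KB x y : K x -> K y -> K (x - y).
  by move=> Kx Ky; rewrite addrC -scaleN1r; exact: KD.
have uniq y p : K p -> (forall k, K k -> inner (y - p) k = 0) -> E y = p.
  move=> Kp hp; apply/eqP; rewrite -subr_eq0; apply/eqP/inner_eq0.
  have KEp : K (E y - p) by exact: KB.
  have -> : inner (E y - p) (E y - p) =
      inner (y - p) (E y - p) - inner (y - E y) (E y - p).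
    by rewrite -innerBl; congr (inner _ _); rewrite opprB [RHS]addrC addrA subrK.
  by rewrite hp// Eo// subr0.
have Elin : linear E.
  move=> c x y; apply: uniq => [|k Kk]; first exact: KD.
  by rewrite opprD addrACA -scalerBr innerDl innerZl !Eo// mulr0 addr0.
have EK y : K y -> E y = y.
  by move=> Ky; apply: uniq => // k _; rewrite subrr inner0l.
exists E; last by [].
split.
- split=> //; exists 1 => x; rewrite mul1r.
  have -> : `|x| = `|E x + (x - E x)| by rewrite addrC subrK.
  rewrite -(@ler_pXn2r _ 2) ?nnegrE// sqr_normD Eo// (inner_sym0 (Eo _ _ _))//.
  by rewrite !addr0 lerDl exprn_ge0.
- by apply/funext => y /=; rewrite EK.
- move=> x y; apply/eqP; rewrite -subr_eq0; apply/eqP.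
  have -> : inner (E x) y - inner x (E y) =
     inner (E x) (y - E y) - inner (x - E x) (E y).
    by rewrite innerBr innerBl; ring.
  by rewrite Eo// (inner_sym0 (Eo _ _ _))// subr0.
Qed.

(** The representing vector is a multiple of a vector [w] orthogonal to the
kernel of [f]: the combination [f w *: x - f x *: w] is always in that kernel. *)
Lemma riesz (f : H -> R[i]) : (forall c x y, f (c *: x + y) = c * f x + f y) ->
  (exists M : R, forall x, `|f x| <= M%:C * `|x|) ->
  exists u, forall x, f x = inner x u.
Proof.
move=> flin [M fM].
have f0 : f 0 = 0.
  have := flin (-1) 0 0; rewrite scaler0 addr0 => ->; ring.
have fB x y : f (x - y) = f x - f y by rewrite addrC -scaleN1r flin; ring.
have Ksub : closed_subspace [set x | f x = 0].
  split=> //= [c x y fx fy|y hy]; first by rewrite flin fx fy mulr0 addr0.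
  apply/eqP; rewrite -normr_eq0; apply/negPn/negP => fy0.
  have M0 : 0 < (`|M| + 1)%:C :> R[i] by rewrite ltcR ltr_wpDl.
  have [|k /= fk] := hy (`|f y| / (`|M| + 1)%:C).
    by rewrite divr_gt0// lt0r fy0 normr_ge0.
  rewrite ltr_pdivlMr// => h.
  have := fM (y - k); rewrite fB fk subr0 => h2.
  have := lt_le_trans h h2; rewrite mulrC => {}h.
  have : `|y - k| * (`|M| + 1)%:C < `|y - k| * (`|M| + 1)%:C.
    rewrite [X in X < _]mulrC; apply: (lt_le_trans h).
    by rewrite mulrC ler_wpM2l// lecR (le_trans (ler_norm _))// lerDl.
  by rewrite ltxx.
have [h|/existsNP[z fz]] := pselect (forall x, f x = 0).
  by exists 0 => x; rewrite h inner0r.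
have [p /= fp hp] := orthogonal_projection_point z Ksub.
set w := z - p in hp.
have fw : f w = f z by rewrite fB fp subr0.
have w0 : inner w w != 0.
  apply/eqP => /inner_eq0 w0; apply: fz; by rewrite -fw w0 f0.
exists ((f w / inner w w)^*%C *: w) => x; rewrite innerZr conjcK.
have := hp (f w *: x - f x *: w); rewrite /= => hx.
have {}hx : inner (f w *: x - f x *: w) w = 0.
  apply: inner_sym0; apply: hx; rewrite fB -[f w *: x]addr0 flin.
  by rewrite -[f x *: w]addr0 flin f0; ring.
move: hx; rewrite innerBl !innerZl => /eqP; rewrite subr_eq0 => /eqP hx.
by rewrite mulrAC hx mulfK.
Qed.

(** * Projections, their joins and their meets *)

Lemma norm_small_eq0 x : (forall e, 0 < e -> `|x| < e) -> x = 0.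
Proof.
move=> h; apply/eqP; rewrite -normr_eq0; apply/negPn/negP => x0.
by have := h `|x|; rewrite ltxx lt0r x0 normr_ge0 => /(_ isT).
Qed.

Lemma linear_op0 T : linear T -> T 0 = 0.
Proof. by move=> h; rewrite -[0 in LHS](subrr 0) -scaleN1r addrC h scaleN1r addNr. Qed.

Lemma linear_opD T : linear T -> forall x y, T (x + y) = T x + T y.
Proof. by move=> h x y; rewrite -[x in LHS]scale1r h scale1r. Qed.

Lemma linear_opZ T : linear T -> forall c x, T (c *: x) = c *: T x.
Proof. by move=> h c x; rewrite -[c *: x]addr0 h linear_op0// addr0. Qed.

Lemma linear_opB T : linear T -> forall x y, T (x - y) = T x - T y.
Proof. by move=> h x y; rewrite addrC -scaleN1r h scaleN1r addrC. Qed.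

Lemma bounded_operator_pos T : bounded_operator T ->
  exists2 M : R, 0 < M & forall x, `|T x| <= M%:C * `|x|.
Proof.
move=> [_ [M hM]]; exists (`|M| + 1); first by rewrite ltr_wpDl.
move=> x; apply: (le_trans (hM x)); rewrite ler_wpM2r// lecR.
by rewrite (le_trans (ler_norm _))// lerDl.
Qed.

Lemma perpE P x : perp P x = x - P x.
Proof. by []. Qed.

Section Projections.
Variables (P : H -> H) (prP : projection P).

Lemma proj_linear : linear P.
Proof. by case: prP => [[]]. Qed.

Lemma projB x y : P (x - y) = P x - P y.
Proof. exact: linear_opB proj_linear _ _. Qed.

Lemma projD x y : P (x + y) = P x + P y.
Proof. exact: linear_opD proj_linear _ _. Qed.

Lemma projZ c x : P (c *: x) = c *: P x.
Proof. exact: linear_opZ proj_linear _ _. Qed.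

Lemma proj0 : P 0 = 0.
Proof. exact: linear_op0 proj_linear. Qed.

Lemma projK x : P (P x) = P x.
Proof. by case: prP => _ /(congr1 (fun f => f x)). Qed.

Lemma proj_adj x y : inner (P x) y = inner x (P y).
Proof. by case: prP. Qed.

Lemma inner_proj x : inner (P x) x = `|P x| ^+ 2.
Proof. by rewrite norm_innerE [RHS]proj_adj projK proj_adj. Qed.

Lemma inner_proj_neq0 x : P x != 0 -> inner (P x) x != 0.
Proof. by move=> h; rewrite inner_proj expf_neq0// normr_eq0. Qed.

Lemma proj_pythagoras x : `|x| ^+ 2 = `|P x| ^+ 2 + `|x - P x| ^+ 2.
Proof.
have h : inner (x - P x) (P x) = 0 by rewrite -proj_adj projB projK subrr inner0l.
by have := sqr_normD (x - P x) (P x); rewrite subrK h (inner_sym0 h) !addr0 addrC.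
Qed.

Lemma norm_proj_perp x : `|x - P x| <= `|x|.
Proof.
rewrite -(@ler_pXn2r _ 2) ?nnegrE// [leRHS](proj_pythagoras x).
by rewrite lerDr exprn_ge0.
Qed.

Lemma perp_projection : projection (perp P).
Proof.
split.
- split; first by move=> c x y; rewrite !perpE projD projZ opprD addrACA -scalerBr.
  by exists 1 => x; rewrite mul1r perpE norm_proj_perp.
- by apply/funext => x; rewrite /= !perpE projB projK subrr subr0.
- by move=> x y; rewrite !perpE innerBl innerBr proj_adj.
Qed.

Lemma perp_comp_eq0 T x : perp P (T x) = 0 <-> P (T x) = T x.
Proof.
rewrite perpE; split=> [/eqP|->]; last by rewrite subrr.
by rewrite subr_eq0 => /eqP.
Qed.
End Projections.

Lemma proj_leP P Q : proj_le P Q <-> forall x, Q (P x) = P x.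
Proof. by split=> [h x|h]; [move/(congr1 (fun f => f x)): h|exact/funext]. Qed.

Lemma proj_le_refl P : projection P -> proj_le P P.
Proof. by case. Qed.

Lemma proj_leC P Q : projection P -> projection Q -> proj_le P Q ->
  forall x, P (Q x) = P x.
Proof.
move=> prP prQ /proj_leP h x; apply/eqP; rewrite -subr_eq0; apply/eqP/inner_eq0.
set w := P (Q x) - P x.
by rewrite {1}/w innerBl !proj_adj// h -proj_adj// subrr.
Qed.

Lemma proj_le_trans Q P S : proj_le P Q -> proj_le Q S -> proj_le P S.
Proof. by move=> /proj_leP h1 /proj_leP h2; apply/proj_leP => x; rewrite -h1 h2. Qed.

Lemma proj_le_anti P Q : projection P -> projection Q ->
  proj_le P Q -> proj_le Q P -> P = Q.
Proof.
move=> prP prQ h1 /proj_leP h2; apply/funext => x.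
by rewrite -(proj_leC prP prQ h1) h2.
Qed.

Lemma perp_le P Q : projection P -> projection Q -> proj_le P Q ->
  proj_le (perp Q) (perp P).
Proof.
move=> prP prQ h; apply/proj_leP => x; rewrite !perpE.
by rewrite projB// (proj_leC prP prQ h) subrr subr0.
Qed.

Lemma perpK P : perp (perp P) = P.
Proof. by rewrite /perp opprB addrC subrK. Qed.

Definition proj_chain A := forall P Q, A P -> A Q -> proj_le P Q \/ proj_le Q P.

(** A join of a chain is its strong limit.  The vectors [y] that are limits of
[Q y] for [Q] in [A] form a closed subspace, additivity using that [A] is a
chain; the projection onto it is an upper bound of [A], hence lies above the
join. *)
Lemma join_approx A P y : A `<=` projection -> proj_chain A -> A !=set0 ->
  is_join A P -> approximable [set Q y | Q in A] (P y).
Proof.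
move=> Apr Ach [Q0 AQ0] [prP ubP lubP].
pose K := [set y | forall e, 0 < e -> exists2 Q, A Q & `|y - Q y| < e].
have mono Q S x : A Q -> A S -> proj_le Q S -> `|x - S x| <= `|x - Q x|.
  move=> AQ AS /proj_leP QS; apply: le_trans (norm_proj_perp (Apr _ AS) _).
  by rewrite (projB (Apr _ AS)) QS opprB addrA subrK.
have Ksub : closed_subspace K.
  split.
  - move=> e e0; exists Q0 => //; by rewrite (proj0 (Apr _ AQ0)) subrr normr0.
  - move=> c u v Ku Kv e e0.
    have c0 : 0 < `|c| + 1 by rewrite ltr_wpDl.
    have [|Q1 AQ1 h1] := Ku (e / 2 / (`|c| + 1)); first by rewrite !divr_gt0.
    have [|Q2 AQ2 h2] := Kv (e / 2); first by rewrite divr_gt0.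
    have {h1 h2} : exists2 Q, A Q &
       `|u - Q u| < e / 2 / (`|c| + 1) /\ `|v - Q v| < e / 2.
      have [h|h] := Ach _ _ AQ1 AQ2; [exists Q2 => //|exists Q1 => //].
        by split=> //; exact: le_lt_trans (mono _ _ _ AQ1 AQ2 h) h1.
      by split=> //; exact: le_lt_trans (mono _ _ _ AQ2 AQ1 h) h2.
    move=> [Q AQ [h1 h2]]; exists Q => //.
    rewrite (projD (Apr _ AQ)) (projZ (Apr _ AQ)) opprD addrACA -scalerBr.
    apply: (le_lt_trans (ler_normD _ _)); rewrite [e]splitr ler_ltD// normrZ.
    move: h1; rewrite ltr_pdivlMr// => /ltW; apply: le_trans.
    by rewrite mulrC ler_wpM2l// lerDl.
  - move=> v hv e e0; have e3 : 0 < e / 3 by rewrite divr_gt0.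
    have [k Kk hk] := hv _ e3; have [Q AQ hQ] := Kk _ e3; exists Q => //.
    have -> : v - Q v = ((v - k) - Q (v - k)) + (k - Q k).
      by rewrite (projB (Apr _ AQ)) opprB addrACA subrK [Q k - _ - _]addrAC subrr add0r.
    apply: (le_lt_trans (ler_normD _ _)).
    have -> : e = e / 3 + e / 3 + e / 3 by field.
    rewrite ltrD//; apply: le_lt_trans (norm_proj_perp (Apr _ AQ) _) _.
    by rewrite (lt_le_trans hk)// lerDl ltW.
have [E prE [KE EK]] := projection_onto Ksub.
have /(_ prE)/proj_leP EP : projection E -> proj_le P E.
  move/lubP; apply => Q AQ; apply/proj_leP => x; apply: EK => e e0.
  by exists Q => //; rewrite (projK (Apr _ AQ)) subrr normr0.
move=> e e0; have [Q AQ] := KE (P y) _ e0.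
rewrite EP (proj_leC (Apr _ AQ) prP (ubP _ AQ)) => h.
by exists (Q y) => //; exists Q.
Qed.

(** Taking [perp] reverses the order and turns the meet into a join. *)
Lemma meet_approx A P y : A `<=` projection -> proj_chain A -> A !=set0 ->
  is_meet A P -> approximable [set Q y | Q in A] (P y).
Proof.
move=> Apr Ach [Q0 AQ0] [prP lbP glbP].
have joinperp : is_join [set perp Q | Q in A] (perp P).
  split; first exact: perp_projection.
    by move=> _ [Q AQ <-]; apply: perp_le => //; [exact: Apr|exact: lbP].
  move=> S prS hS; rewrite -[S]perpK; apply: perp_le => //.
    exact: perp_projection.
  apply: glbP; first exact: perp_projection.
  move=> Q AQ; rewrite -[Q]perpK; apply: perp_le => //.
    exact/perp_projection/Apr.
  by apply: hS; exists Q.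
move=> e e0.
have [|||_ [_ [Q AQ <-] <-] h] := join_approx y _ _ _ joinperp e0.
- by move=> _ [Q AQ <-]; exact/perp_projection/Apr.
- move=> _ _ [Q AQ <-] [S AS <-]; have prQ := Apr _ AQ; have prS := Apr _ AS.
  by have [h|h] := Ach _ _ AQ AS; [right|left]; exact: perp_le.
- by exists (perp Q0), Q0.
exists (Q y); first by exists Q.
by move: h; rewrite !perpE opprB addrC addrA subrK -normrN opprB.
Qed.

Lemma join_eq0 A P y : A `<=` projection -> proj_chain A -> A !=set0 ->
  is_join A P -> (forall Q, A Q -> Q y = 0) -> P y = 0.
Proof.
move=> Apr Ach A0 AP h; apply: norm_small_eq0 => e e0.
have [_ [Q AQ <-]] := join_approx y Apr Ach A0 AP e0.
by rewrite (h _ AQ) subr0.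
Qed.

Lemma meet_fix A P y : A `<=` projection -> proj_chain A -> A !=set0 ->
  is_meet A P -> (forall Q, A Q -> Q y = y) -> P y = y.
Proof.
move=> Apr Ach A0 AP h; apply/eqP; rewrite -subr_eq0; apply/eqP.
apply: norm_small_eq0 => e e0.
have [_ [Q AQ <-]] := meet_approx y Apr Ach A0 AP e0.
by rewrite (h _ AQ).
Qed.

Lemma joinE A P : is_join A P -> join A = P.
Proof.
move=> [prP ub lub]; have [prJ ubJ lubJ] : is_join A (join A).
  by apply: xgetPex; exists P.
by apply: proj_le_anti => //; [exact: lubJ|exact: lub].
Qed.

Lemma meetE A P : is_meet A P -> meet A = P.
Proof.
move=> [prP lb glb]; have [prJ lbJ glbJ] : is_meet A (meet A).
  by apply: xgetPex; exists P.
by apply: proj_le_anti => //; [exact: glb|exact: glbJ].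
Qed.

(** * Nests and continuity *)

Section Nest.
Variables (N : set (H -> H)) (Nc : complete_nest N).

Lemma nest_proj : N `<=` projection.
Proof. by case: Nc. Qed.

Lemma nest_chain : proj_chain N.
Proof. by case: Nc. Qed.

Lemma nest0 : N 0.
Proof. by case: Nc => _ _ []. Qed.

Lemma nest1 : N idfun.
Proof. by case: Nc => _ _ []. Qed.

Lemma join_nest A : A `<=` N -> N (join A) /\ is_join A (join A).
Proof.
by move=> AN; have [_ _ _ /(_ _ AN) [[P NP jP] _]] := Nc; rewrite (joinE jP).
Qed.

Lemma meet_nest A : A `<=` N -> N (meet A) /\ is_meet A (meet A).
Proof.
by move=> AN; have [_ _ _ /(_ _ AN) [_ [P NP mP]]] := Nc; rewrite (meetE mP).
Qed.

Lemma sub_chain A : A `<=` N -> A `<=` projection /\ proj_chain A.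
Proof.
move=> AN; split=> [P /AN/nest_proj//|P Q AP AQ]; exact: nest_chain (AN _ AP) (AN _ AQ).
Qed.

Lemma nest_not_le P Q : N P -> N Q -> ~ proj_le P Q -> proj_lt Q P.
Proof.
move=> NP NQ h; have [//|QP] := nest_chain NP NQ; split=> // QeP.
by apply: h; rewrite QeP; exact/proj_le_refl/nest_proj.
Qed.

Lemma nest_lt_not_le P Q : N P -> N Q -> proj_lt Q P -> ~ proj_le P Q.
Proof.
move=> NP NQ [QP QneP] PQ; apply: QneP.
by apply: proj_le_anti => //; exact: nest_proj.
Qed.

Lemma vec_proj_nest z : N (vec_proj N z).
Proof. by apply: (meet_nest _).1 => Q []. Qed.

Lemma vec_hat_nest z : N (vec_hat N z).
Proof. by apply: (join_nest _).1 => Q []. Qed.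

Lemma vec_proj_fix z : vec_proj N z z = z.
Proof.
have AN : [set Q | N Q /\ Q z = z] `<=` N by move=> Q [].
have [pr ch] := sub_chain AN.
apply: (meet_fix pr ch _ (meet_nest AN).2) => [|Q []//].
by exists idfun; split=> //; exact: nest1.
Qed.

Lemma vec_proj_le z Q : N Q -> Q z = z -> proj_le (vec_proj N z) Q.
Proof.
move=> NQ Qz; have AN : [set Q | N Q /\ Q z = z] `<=` N by move=> S [].
by have [_ [_ lb _]] := meet_nest AN; exact: lb.
Qed.

Lemma vec_hat_eq0 z : vec_hat N z z = 0.
Proof.
have AN : [set Q | N Q /\ Q z = 0] `<=` N by move=> Q [].
have [pr ch] := sub_chain AN.
apply: (join_eq0 pr ch _ (join_nest AN).2) => [|Q []//].
by exists 0; split=> //; exact: nest0.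
Qed.

Lemma le_vec_hat z Q : N Q -> Q z = 0 -> proj_le Q (vec_hat N z).
Proof.
move=> NQ Qz; have AN : [set Q | N Q /\ Q z = 0] `<=` N by move=> S [].
by have [_ [_ ub _]] := join_nest AN; exact: ub.
Qed.

Lemma vec_hat_lt z P : N P -> proj_lt (vec_hat N z) P <-> P z <> 0.
Proof.
move=> NP; split=> [lt /(le_vec_hat NP)|Pz].
  by apply: nest_lt_not_le lt => //; exact: vec_hat_nest.
apply: nest_not_le => //; first exact: vec_hat_nest.
move=> le; apply: Pz.
rewrite -(proj_leC (nest_proj NP) (nest_proj (vec_hat_nest z)) le) vec_hat_eq0.
exact: proj0 (nest_proj NP).
Qed.

End Nest.

Section ContinuousNest.
Variables (N : set (H -> H)) (Ncont : continuous_nest N).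
Let Nc : complete_nest N := Ncont.1.

Lemma continuous_is_join P : N P -> P <> 0 -> is_join [set Q | N Q /\ proj_lt Q P] P.
Proof.
move=> NP P0; have := Ncont.2 _ NP; rewrite /nest_pred asboolF// => {2}<-.
by apply: (join_nest Nc _).2 => Q [].
Qed.

Lemma continuous_left P y : N P -> P <> 0 ->
  approximable [set Q y | Q in [set Q | N Q /\ proj_lt Q P]] (P y).
Proof.
move=> NP P0; have AN : [set Q | N Q /\ proj_lt Q P] `<=` N by move=> Q [].
have [pr ch] := sub_chain Nc AN.
apply: join_approx pr ch _ (continuous_is_join NP P0).
exists 0; split; first exact: nest0.
split; last exact/nesym.
by apply/proj_leP => x; exact: proj0 (nest_proj Nc NP).
Qed.

Lemma continuous_dense Q P : N Q -> N P -> proj_lt Q P ->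
  exists R, [/\ N R, proj_lt Q R & proj_lt R P].
Proof.
move=> NQ NP QP; apply: contrapT => h.
apply: (nest_lt_not_le Nc NP NQ QP).
have P0 : P <> 0.
  move=> P0; apply: (nest_lt_not_le Nc NP NQ QP); rewrite P0.
  by apply/proj_leP => x; exact: proj0 (nest_proj Nc NQ).
have [_ _ lub] := continuous_is_join NP P0.
apply: lub; first exact: nest_proj NQ.
move=> S [NS SP]; apply: contrapT => nSQ; apply: h; exists S; split=> //.
exact (nest_not_le Nc NS NQ nSQ).
Qed.

(** Continuity is stated through predecessors only, but it also excludes right
gaps: if the meet of the elements above [Q] were larger than [Q], density would
give an element strictly in between. *)
Lemma continuous_right Q y : N Q -> Q <> idfun ->
  approximable [set P y | P in [set P | N P /\ proj_lt Q P]] (Q y).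
Proof.
move=> NQ Q1; have AN : [set P | N P /\ proj_lt Q P] `<=` N by move=> P [].
have [pr ch] := sub_chain Nc AN.
have [NM mM] := meet_nest Nc AN; have [prM lbM glbM] := mM.
have QM : proj_le Q (meet [set P | N P /\ proj_lt Q P]).
  by apply: glbM => [|S [_ []]//]; exact: nest_proj NQ.
suff {2}-> : Q = meet [set P | N P /\ proj_lt Q P].
  apply: meet_approx pr ch _ mM; exists idfun; split; first exact: nest1.
  by split=> //; apply/proj_leP.
apply: contrapT => QneM.
have [S [NS QS SM]] := continuous_dense NQ NM (conj QM QneM).
by apply: (nest_lt_not_le Nc NM NS SM); apply: lbM.
Qed.

(** Gaps of a continuous nest are infinite dimensional: splitting the gap in two
gives orthogonal vectors [a1] and [a2], and one combination of them satisfies one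
more orthogonality condition. *)
Lemma orthogonal_in_gap n (v : 'I_n -> H) Q P : N Q -> N P -> proj_lt Q P ->
  exists a, [/\ a != 0, P a = a, Q a = 0 & forall i, inner (v i) a = 0].
Proof.
elim: n v Q P => [|n IH] v Q P NQ NP QP.
  have prQ := nest_proj Nc NQ; have prP := nest_proj Nc NP.
  have [QP1 QP2] := QP.
  have [x hx] : exists x, P x - Q x <> 0.
    apply: contrapT => h; apply: QP2; apply/funext => x.
    apply/eqP; rewrite eq_sym -subr_eq0; apply/eqP; apply: contrapT => hx.
    by apply: h; exists x.
  exists (P x - Q x); split=> [||| []//]; first exact/eqP.
    by rewrite projB// projK//; move/proj_leP: QP1 => ->.
  by rewrite projB// projK// (proj_leC prQ prP)// subrr.
have [R0 [NR QR RP]] := continuous_dense NQ NP QP.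
have prQ := nest_proj Nc NQ; have prP := nest_proj Nc NP.
have prR := nest_proj Nc NR.
have [a1 [a10 Ra1 Qa1 o1]] := IH (v \o lift ord0) _ _ NQ NR QR.
have [a2 [a20 Pa2 Ra2 o2]] := IH (v \o lift ord0) _ _ NR NP RP.
have Pa1 : P a1 = a1 by rewrite -Ra1; move/proj_leP: RP.1; exact.
have Qa2 : Q a2 = 0 by rewrite -(proj_leC prQ prR QR.1) Ra2 proj0.
have [h|h] := eqVneq (inner (v ord0) a1) 0.
  by exists a1; split=> // i; have [j ->|->//] := unliftP ord0 i; exact: o1.
pose c1 := inner a1 (v ord0); pose c2 := inner a2 (v ord0).
have c10 : c1 != 0 by rewrite /c1 innerC conjc_eq0.
exists (c1 *: a2 - c2 *: a1); split.
- apply/eqP => /(congr1 (fun z => z - R0 z)) /=.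
  rewrite (projB prR) !(projZ prR) Ra2 Ra1 (proj0 prR) scaler0 sub0r opprK subrK subr0.
  by move/eqP; rewrite scaler_eq0 (negbTE c10) (negbTE a20).
- by rewrite (projB prP) !(projZ prP) Pa1 Pa2.
- by rewrite (projB prQ) !(projZ prQ) Qa1 Qa2 !scaler0 subr0.
- move=> i; rewrite innerBr !innerZr.
  rewrite -!innerC; have [j ->|->] := unliftP ord0 i; last by rewrite mulrC subrr.
  by move: (o1 j) (o2 j) => /= -> ->; rewrite !mulr0 subrr.
Qed.
End ContinuousNest.

(** * Bounded and rank one operators *)

Lemma rank_one_linear x y : linear (rank_one x y).
Proof. by move=> c u v; rewrite /rank_one innerDl innerZl scalerDl scalerA. Qed.

Lemma rank_one0r x : rank_one x 0 = 0.
Proof. by apply/funext => z; rewrite /rank_one scaler0. Qed.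

Lemma rank_one0l y : rank_one 0 y = 0.
Proof. by apply/funext => z; rewrite /rank_one inner0r scale0r. Qed.

Lemma norm_rank_one x y z : `|rank_one x y z| <= `|x| * `|y| * `|z|.
Proof.
rewrite /rank_one normrZ mulrAC ler_wpM2r// mulrC; exact: norm_cauchy_schwarz.
Qed.

Lemma bounded_rank_one x y : bounded_operator (rank_one x y).
Proof.
split; first exact: rank_one_linear.
exists (complex.Re `|x| * complex.Re `|y|) => z.
by rewrite rmorphM /= !normRe norm_rank_one.
Qed.

Lemma bounded_addZ c S T : bounded_operator S -> bounded_operator T ->
  bounded_operator (S + c *: T).
Proof.
move=> [Sl [M1 h1]] [Tl [M2 h2]]; split.
  move=> a x y; rewrite !fctE Sl Tl !scalerDr !scalerA [c * a]mulrC.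
  by rewrite addrACA.
have [k ck] : exists k : R, `|c| = k%:C by apply/complex_realP/normr_real.
exists (M1 + k * M2) => x; rewrite !fctE.
apply: (le_trans (ler_normD _ _)).
rewrite rmorphD rmorphM /= -ck mulrDl lerD//.
by rewrite normrZ -mulrA ler_wpM2l.
Qed.

Lemma opnorm_le T (r : R) : (forall x, `|x| <= 1 -> `|T x| <= r%:C) -> opnorm T <= r.
Proof.
move=> h; apply: ge_sup.
  by exists (complex.Re `|T 0|), 0 => //=; rewrite normr0 ler01.
by move=> _ [x /= x1 <-]; rewrite -lecR normRe h.
Qed.

(** * Finite spans *)

Definition spanned n (v : 'I_n -> H) x := exists c : 'I_n -> R[i], x = \sum_i c i *: v i.

Lemma spanned_comb n (v : 'I_n -> H) c x y :
  spanned v x -> spanned v y -> spanned v (c *: x + y).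
Proof.
move=> [a ->] [b ->]; exists (fun i => c * a i + b i).
by rewrite scaler_sumr -big_split; apply: eq_bigr => i _; rewrite scalerDl scalerA.
Qed.

Lemma spanned_recl n (v : 'I_n.+1 -> H) x : spanned v x ->
  exists c s, x = c *: v ord0 + s /\ spanned (v \o lift ord0) s.
Proof.
move=> [c ->]; rewrite big_ord_recl; eexists; eexists; split=> //.
by exists (c \o lift ord0).
Qed.

Definition comb_closed (V : set H) := forall c x y, V x -> V y -> V (c *: x + y).

(** By induction on the number of spanning vectors.  Either all the members of the
chain meet the span of the last [n] vectors, and the traces on it form such a
chain again; or some member [V] meets it trivially, so [V] is a line, and every
member of the chain contains that line. *)
Lemma chain_common_vector n (v : 'I_n -> H) (F : set (set H)) :
    F !=set0 ->
    (forall V W, F V -> F W -> V `<=` W \/ W `<=` V) ->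
    (forall V, F V -> comb_closed V) ->
    (forall V, F V -> V `<=` spanned v) ->
    (forall V, F V -> exists2 x, V x & x != 0) ->
  exists2 x, x != 0 & forall V, F V -> V x.
Proof.
elim: n v F => [|n IH] v F [V0 FV0] ch lin sp nz.
  have [x Vx /eqP[]] := nz _ FV0.
  by have [c ->] := sp _ FV0 _ Vx; rewrite big_ord0.
pose v' := v \o lift ord0.
have V0c V x : F V -> V x -> V 0.
  by move=> FV Vx; rewrite -(addNr x) -scaleN1r; exact: lin.
have VZ V c x : F V -> V x -> V (c *: x).
  by move=> FV Vx; rewrite -[_ *: _]addr0; apply: (lin _ FV) => //; exact: V0c Vx.
have [h|] := pselect (forall V, F V -> exists2 x, V x /\ spanned v' x & x != 0).
  have [|||||x x0 hx] := IH v' [set V `&` spanned v' | V in F].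
  - by exists (V0 `&` spanned v'), V0.
  - move=> _ _ [V FV <-] [W FW <-].
    by have [le|le] := ch _ _ FV FW; [left|right]; exact: setSI.
  - move=> _ [V FV <-] c x y [Vx sx] [Vy sy].
    by split; [exact: lin|exact: spanned_comb].
  - by move=> _ [V FV <-] x [].
  - by move=> _ [V FV <-]; exact: h.
  by exists x => // V FV; have [] := hx _ (ex_intro2 _ _ V FV erefl).
move=> /existsNP[V /not_implyP[FV noV]].
have triv x : V x -> spanned v' x -> x = 0.
  move=> Vx sx; apply/eqP/negPn/negP => x0; apply: noV; by exists x.
have [x Vx x0] := nz _ FV; exists x => // W FW.
have [VW|WV] := ch _ _ FV FW; first exact: VW.
have [y Wy y0] := nz _ FW; have Vy := WV _ Wy.
have [a [s [xE ss]]] := spanned_recl (sp _ FV _ Vx).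
have [b [t [yE st]]] := spanned_recl (sp _ FV _ Vy).
(* The combination eliminates [v ord0], so it is in the trivial trace of [V]. *)
have dep : b *: x - a *: y = 0.
  apply: triv.
    by rewrite addrC -scaleNr; apply: (lin _ FV) => //; exact: VZ.
  have -> : b *: x - a *: y = b *: s + ((- a) *: t + 0).
    rewrite xE yE !scalerDr !scalerA mulrC opprD addrACA subrr add0r addr0.
    by rewrite scaleNr.
  apply: spanned_comb => //; apply: spanned_comb => //.
  by exists (fun=> 0); rewrite big1// => i _; rewrite scale0r.
have b0 : b != 0.
  apply: contra_neq y0 => b0; apply: triv => //.
  by rewrite yE b0 scale0r add0r.
have -> : x = (a / b) *: y.
  move/eqP: dep; rewrite subr_eq0 => /eqP dep.
  by rewrite mulrC -scalerA -dep scalerA mulVf// scale1r.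
exact: VZ.
Qed.

Lemma spanned_drop n (v : 'I_n.+1 -> H) j (d : 'I_n.+1 -> R[i]) x :
  d j != 0 -> \sum_i d i *: v i = 0 -> spanned v x ->
  spanned (v \o lift j) x.
Proof.
move=> dj dv [c ->].
exists (fun i => c (lift j i) - c j / d j * d (lift j i)).
have -> : \sum_i c i *: v i = \sum_i (c i - c j / d j * d i) *: v i.
  under [RHS]eq_bigr do rewrite scalerBl -scalerA.
  by rewrite sumrB -scaler_sumr dv scaler0 subr0.
by rewrite (bigD1_ord j)//= divfK// subrr scale0r add0r.
Qed.

(** * Lie ideals *)

Section Lie.
Variables (N L : set (H -> H)).
Hypotheses (N_continuous : continuous_nest N).
Hypotheses (L_lie : lie_ideal N L) (L_closed : norm_closed L).
Let Nc : complete_nest N := N_continuous.1.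
Local Notation phi := (lie_hom N L).

(** Norm closedness, used through rank one operators with one factor fixed: these
depend continuously on the other factor. *)
Lemma closed_rank_one_r x y :
  approximable [set w | L (rank_one x w)] y -> L (rank_one x y).
Proof.
move=> h; apply: L_closed; first exact: bounded_rank_one.
move=> r r0; have x0 : 0 < `|x| + 1 by rewrite ltr_wpDl.
have [|w Lw hw] := h ((r / 2)%:C / (`|x| + 1)).
  by rewrite divr_gt0// ltcR divr_gt0.
exists (rank_one x w) => //; apply: (@le_lt_trans _ _ (r / 2)).
  apply: opnorm_le => z z1.
  have -> : (rank_one x y - rank_one x w) z = rank_one x (y - w) z.
    by rewrite !fctE /rank_one scalerBr.
  apply: (le_trans (norm_rank_one _ _ _)).
  move: hw; rewrite ltr_pdivlMr// => /ltW; apply: le_trans.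
  rewrite -[leRHS]mulr1 ler_pM ?mulr_ge0// mulrC ler_wpM2l//.
  by rewrite lerDl.
by rewrite ltr_pdivrMr// ltr_pMr// ltr1n.
Qed.

Lemma closed_rank_one_l x y :
  approximable [set w | L (rank_one w y)] x -> L (rank_one x y).
Proof.
move=> h; apply: L_closed; first exact: bounded_rank_one.
move=> r r0; have x0 : 0 < `|y| + 1 by rewrite ltr_wpDl.
have [|w Lw hw] := h ((r / 2)%:C / (`|y| + 1)).
  by rewrite divr_gt0// ltcR divr_gt0.
exists (rank_one w y) => //; apply: (@le_lt_trans _ _ (r / 2)).
  apply: opnorm_le => z z1.
  have -> : (rank_one x y - rank_one w y) z = rank_one (x - w) y z.
    by rewrite !fctE /rank_one innerBr scalerBl.
  apply: (le_trans (norm_rank_one _ _ _)).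
  move: hw; rewrite ltr_pdivlMr// => /ltW; apply: le_trans.
  rewrite -[leRHS]mulr1 ler_pM ?mulr_ge0// ler_wpM2l//.
  by rewrite lerDl.
by rewrite ltr_pdivrMr// ltr_pMr// ltr1n.
Qed.

Lemma lie_scale c T : c != 0 -> L (c *: T) -> L T.
Proof.
move=> c0 LT; have [_ _ _ LZ _] := L_lie.
by have := LZ c^-1 _ LT; rewrite scalerA mulVf// scale1r.
Qed.

Lemma rank_one_nest_algebra a b Q : N Q -> Q a = 0 -> Q b = b ->
  nest_algebra N (rank_one a b).
Proof.
move=> NQ Qa Qb; split; first exact: bounded_rank_one.
move=> P NP; apply/funext => z; rewrite /= /rank_one perpE.
have prP := nest_proj Nc NP; have prQ := nest_proj Nc NQ.
rewrite projZ// -scalerBr; have [/proj_leP h|/proj_leP h] := nest_chain Nc NP NQ.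
  by rewrite -h proj_adj// Qa inner0r scale0r.
by rewrite -Qb h subrr scaler0.
Qed.

Lemma nest_algebra_fix T P x : nest_algebra N T -> N P -> P (T (P x)) = T (P x).
Proof.
move=> [_ h] /h /(congr1 (fun f => f x)) /=.
by rewrite perpE => /eqP; rewrite subr_eq0 => /eqP.
Qed.

(** The family of which [lie_hom N L P] is by definition the join. *)
Definition lie_hom_set P : set (H -> H) := [set Q | exists x y,
    [/\ Q = vec_proj N y, L (rank_one x y) & proj_lt (vec_hat N x) P]].

Lemma lie_hom_set_nest P : lie_hom_set P `<=` N.
Proof. by move=> _ [x [y [-> _ _]]]; exact: vec_proj_nest. Qed.

Lemma lie_hom_nest P : N (phi P).
Proof. exact: (join_nest Nc (@lie_hom_set_nest P)).1. Qed.

Lemma lie_hom_join P : is_join (lie_hom_set P) (phi P).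
Proof. exact: (join_nest Nc (@lie_hom_set_nest P)).2. Qed.

Lemma proj_lt_le_trans Q P S : N Q -> N P -> N S -> proj_lt Q P -> proj_le P S ->
  proj_lt Q S.
Proof.
move=> NQ NP NS QP PS; apply: (nest_not_le Nc NS NQ) => SQ.
by apply: (nest_lt_not_le Nc NP NQ QP); exact: proj_le_trans SQ.
Qed.

Lemma lie_hom_mono P Q : N P -> N Q -> proj_le P Q -> proj_le (phi P) (phi Q).
Proof.
move=> NP NQ PQ; have [_ _] := lie_hom_join P; apply.
  exact: nest_proj (lie_hom_nest Q).
move=> _ [x [y [-> Lxy lt]]]; have [_ + _] := lie_hom_join Q; apply.
exists x, y; split=> //.
by apply: proj_lt_le_trans lt PQ => //; exact: vec_hat_nest.
Qed.

Lemma lie_hom_left_continuous : left_order_continuous_hom N (lie_hom N L).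
Proof.
split; [by move=> P _; exact: lie_hom_nest|exact: lie_hom_mono|].
move=> A AN; have [NJ [prJ ubJ lubJ]] := join_nest Nc AN.
apply/esym/joinE; split; first exact: nest_proj (lie_hom_nest _).
  move=> _ [P AP <-]; apply: lie_hom_mono => //; [exact: AN|exact: ubJ].
move=> Q prQ hQ; have [_ _] := lie_hom_join (join A); apply=> //.
move=> _ [x [y [-> Lxy lt]]].
have Nx : N (vec_hat N x) by exact: vec_hat_nest.
have [P AP xP] : exists2 P, A P & proj_lt (vec_hat N x) P.
  apply: contrapT => h; apply: (nest_lt_not_le Nc NJ Nx lt).
  apply: lubJ; first exact: nest_proj Nx.
  move=> P AP; apply: contrapT => nle; apply: h; exists P => //.
  exact (nest_not_le Nc (AN _ AP) Nx nle).
apply: (proj_le_trans (Q := phi P)); last by apply: hQ; exists P.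
by have [_ + _] := lie_hom_join P; apply; exists x, y.
Qed.

(** How the definition of [P'] is used: the hypotheses put [vec_proj N y], which
fixes [y], in the family that [P'] joins. *)
Lemma lie_hom_fix P x y : N P -> L (rank_one x y) -> P x <> 0 -> phi P y = y.
Proof.
move=> NP Lxy Px.
have /proj_leP le : proj_le (vec_proj N y) (phi P).
  have [_ + _] := lie_hom_join P; apply; exists x, y; split=> //.
  exact/vec_hat_lt.
by rewrite -{1}(vec_proj_fix Nc y) le vec_proj_fix.
Qed.

(** For [Q < P], a vector [a] of the gap orthogonal to the range of [T] makes the
commutator of [T] with [rank_one a (Q z)] equal to [rank_one a (T (Q z))]; the
limit [Q -> P] follows from continuity of the nest. *)
Lemma lie_finite_rank_sub T P x : L T -> finite_rank T -> N P ->
  phi P (T (P x)) = T (P x).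
Proof.
move=> LT [n [v Tv]] NP; have [LN L0 LD LZ Lc] := L_lie.
have [[Tlin TM] _] := LN _ LT.
have prP' := nest_proj Nc (lie_hom_nest P).
have [P0|P0] := pselect (P = 0).
  have -> : P x = 0 by rewrite P0.
  by rewrite (linear_op0 Tlin) proj0.
have below Q z : N Q -> proj_lt Q P -> phi P (T (Q z)) = T (Q z).
  move=> NQ QP; have [a [a0 Pa Qa va]] := orthogonal_in_gap N_continuous v NQ NP QP.
  have Ta y : inner (T y) a = 0.
    have [c ->] := Tv y; rewrite inner_suml big1// => i _.
    by rewrite innerZl va mulr0.
  apply: (@lie_hom_fix P a) => //; last by rewrite Pa; exact/eqP.
  have -> : rank_one a (T (Q z)) = commutator T (rank_one a (Q z)).
    apply/funext => y; rewrite /commutator !fctE /= /rank_one Ta scale0r subr0.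
    by rewrite linear_opZ.
  apply: Lc => //; apply: (rank_one_nest_algebra NQ Qa _).
  exact: (projK (nest_proj Nc NQ)).
apply/esym/eqP; rewrite -subr_eq0; apply/eqP; apply: norm_small_eq0 => e e0.
have [M M0 TM'] := bounded_operator_pos (conj Tlin TM).
have M0' : 0 < M%:C :> R[i] by rewrite ltcR.
have [|_ [Q [NQ QP] <-] h] := continuous_left N_continuous x NP P0 (e := e / M%:C).
  by rewrite divr_gt0.
have -> : T (P x) - phi P (T (P x)) = T (P x - Q x) - phi P (T (P x - Q x)).
  by rewrite (linear_opB Tlin) (projB prP') (below Q x)// opprB addrA subrK.
apply: (le_lt_trans (norm_proj_perp prP' _)); apply: (le_lt_trans (TM' _)).
by rewrite mulrC -ltr_pdivlMr.
Qed.

(** The commutator of [rank_one z w] with [rank_one a (P z)] has the single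
surviving term [inner (P z) z *: rank_one a w]: its other term carries the factor
[inner w a], zero because [w] is in the range of [P]. *)
Lemma lie_rank_one_left z w a P : N P -> P z != 0 -> P a = 0 ->
  L (rank_one z w) -> L (rank_one a w).
Proof.
move=> NP Pz Pa Lzw; have [LN L0 LD LZ Lc] := L_lie.
have prP := nest_proj Nc NP.
have Pw : P w = w.
  have := nest_algebra_fix z (LN _ Lzw) NP.
  rewrite /rank_one projZ// => /(scalerI (inner_proj_neq0 prP Pz)); exact.
have wa : inner w a = 0 by rewrite -Pw proj_adj// Pa inner0r.
apply: (@lie_scale (inner (P z) z)); first exact: inner_proj_neq0.
have -> : inner (P z) z *: rank_one a w =
    commutator (rank_one z w) (rank_one a (P z)).
  apply/funext => y; rewrite /commutator !fctE /= /rank_one !innerZl wa.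
  by rewrite mulr0 scale0r subr0 scalerA mulrC.
apply: Lc => //; apply: (rank_one_nest_algebra NP) => //; exact: projK.
Qed.

(** For [Q] strictly below [vec_proj N w], the vector [w - Q w] is nonzero and the
commutator of [rank_one a w] with [rank_one (w - Q w) (Q y)] is a nonzero multiple
of [rank_one a (Q y)]; then [Q] increases to [vec_proj N w]. *)
Lemma lie_rank_one_right a w y P : N P -> P a = 0 -> P w = w ->
  L (rank_one a w) -> L (rank_one a (vec_proj N w y)).
Proof.
move=> NP Pa Pw Law; have [LN L0 LD LZ Lc] := L_lie.
set W := vec_proj N w; have NW : N W by exact: vec_proj_nest.
have prW := nest_proj Nc NW; have prP := nest_proj Nc NP.
have [W0|W0] := pselect (W = 0).
  by have -> : W y = 0 by [rewrite W0]; rewrite rank_one0r.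
apply: closed_rank_one_r => e e0.
have [_ [Q [NQ QW] <-] h] := continuous_left N_continuous y NW W0 e0.
exists (Q y) => //=; have prQ := nest_proj Nc NQ.
have da : inner (Q y) a = 0.
  have /proj_leP <- : proj_le Q P.
    apply: (proj_le_trans QW.1); exact: vec_proj_le.
  by rewrite proj_adj// Pa inner0r.
have Qw : w - Q w != 0.
  rewrite subr_eq0; apply/eqP => Qw; apply: (nest_lt_not_le Nc NW NQ QW).
  exact: vec_proj_le.
have wc : inner w (w - Q w) != 0.
  by rewrite innerC conjc_eq0 -perpE inner_proj_neq0//; exact: perp_projection.
apply: (@lie_scale (- inner w (w - Q w))); first by rewrite oppr_eq0.
have -> : - inner w (w - Q w) *: rank_one a (Q y) =
    commutator (rank_one a w) (rank_one (w - Q w) (Q y)).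
  apply/funext => z; rewrite /commutator !fctE /= /rank_one !innerZl da.
  by rewrite mulr0 scale0r sub0r scaleNr scalerA mulrC.
apply: Lc => //; apply: (rank_one_nest_algebra NQ); last exact: projK.
by rewrite projB// projK// subrr.
Qed.

(** The left factor is approached by [x - P x] for [P] decreasing to
[vec_hat N x], the right factor by [vec_proj N w y] along the chain whose join is
[P']; the two previous lemmas give these approximants. *)
Lemma lie_rank_one_mem x y : (forall P, N P -> P x != 0 -> phi P y = y) ->
  L (rank_one x y).
Proof.
move=> hy; have [LN L0 LD LZ Lc] := L_lie.
have [->|x0] := eqVneq x 0; first by rewrite rank_one0l.
set Q := vec_hat N x; have NQ : N Q by exact: vec_hat_nest.
have Qx : Q x = 0 by exact: vec_hat_eq0.
have Q1 : Q <> idfun by move=> Q1; move: x0; rewrite -Qx Q1 eqxx.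
apply: closed_rank_one_l => e e0.
have [_ [P [NP QP] <-] h] := continuous_right N_continuous x NQ Q1 e0.
exists (x - P x); last by move: h; rewrite Qx sub0r normrN opprB addrC subrK.
have prP := nest_proj Nc NP.
have Px : P x <> 0 by apply/(vec_hat_lt Nc x NP).
have Pa : P (x - P x) = 0 by rewrite projB// projK// subrr.
apply: closed_rank_one_r => {e0 h} {}e e0.
have [pr ch] := sub_chain Nc (@lie_hom_set_nest P).
(* [rank_one x 0 = 0] is in [L], so the family contains [vec_proj N 0]. *)
have ne : lie_hom_set P !=set0.
  by exists (vec_proj N 0), x, 0; split=> //; rewrite rank_one0r.
have [_ [_ [z [w [-> Lzw lt]]] <-] h] := join_approx y pr ch ne (lie_hom_join P) e0.
exists (vec_proj N w y); last by move: h; rewrite hy//; exact/eqP.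
have Pz : P z != 0 by apply/eqP/(vec_hat_lt Nc z NP).
have Lw := lie_rank_one_left NP Pz Pa Lzw.
apply: (lie_rank_one_right _ NP Pa _ Lw).
have := nest_algebra_fix z (LN _ Lzw) NP.
by rewrite /rank_one projZ// => /(scalerI (inner_proj_neq0 prP Pz)).
Qed.

(** Induction on the number of vectors spanning the range of [T], splitting off
the part of [T] along a vector [w] common to all the nonzero ranges
[T (P H)]. *)
Lemma lie_finite_rank_mem n (v : 'I_n -> H) T : bounded_operator T ->
    (forall x, spanned v (T x)) ->
    (forall P x, N P -> phi P (T (P x)) = T (P x)) ->
  L T.
Proof.
elim: n v T => [|n IH] v T Tb Tv TU; have [LN L0 LD LZ Lc] := L_lie.
  have -> // : T = 0.
  by apply/funext => x; have [c ->] := Tv x; rewrite big_ord0.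
have [Tlin _] := Tb.
have [T0|/existsNP[x1 Tx1]] := pselect (forall x, T x = 0).
  by have -> // : T = 0 by exact/funext.
pose F := [set V | exists P, [/\ N P, exists x, T (P x) <> 0 & V = range (T \o P)]].
have [|||||w w0 wF] := @chain_common_vector n.+1 v F.
- by exists (range (T \o idfun)), idfun; split; [exact: nest1|exists x1|].
- suff le P Q : proj_le P Q -> range (T \o P) `<=` range (T \o Q).
    move=> _ _ [P [NP _ ->]] [Q [NQ _ ->]].
    by have [h|h] := nest_chain Nc NP NQ; [left|right]; exact: le.
  by move=> /proj_leP PQ _ [x _ <-]; exists (P x) => //=; rewrite PQ.
- move=> _ [P [NP _ ->]] c _ _ [x _ <-] [y _ <-].
  exists (c *: x + y) => //=.
  by rewrite (proj_linear (nest_proj Nc NP)) Tlin.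
- by move=> _ [P [_ _ ->]] _ [x _ <-]; exact: Tv.
- by move=> _ [P [NP [x /eqP Tx] ->]]; exists (T (P x)) => //; exists x.
have ww : inner w w != 0 by apply: contra_neq w0; exact: inner_eq0.
(* [u] is the value at [w] of the adjoint of [T]. *)
have [u uE] : exists u, forall x, inner (T x) w = inner x u.
  apply: riesz => [c x y|]; first by rewrite Tlin innerDl innerZl.
  have [_ [M hM]] := Tb; exists (M * complex.Re `|w|) => x.
  apply: (le_trans (norm_cauchy_schwarz _ _)).
  by rewrite rmorphM /= normRe mulrAC ler_wpM2r.
have Luw : L (rank_one u w).
  apply: lie_rank_one_mem => P NP Pu.
  have Tx : T (P u) <> 0.
    have := inner_proj_neq0 (nest_proj Nc NP) Pu.
    by rewrite -uE => /eqP + Tu; rewrite Tu inner0l.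
  have [y _ <-] : range (T \o P) w by apply: wF; exists P; split=> //; exists u.
  exact: TU.
(* [E] projects onto the orthogonal of [w]; since it kills [w], the images of the
   spanning vectors are linearly dependent, and one of them can be dropped. *)
pose E x := x - (inner x w / inner w w) *: w.
have Ew : E w = 0 by rewrite /E divff// scale1r subrr.
have Elin : linear E.
  move=> c x y; rewrite /E innerDl innerZl mulrDl scalerDl opprD addrACA.
  by rewrite scalerBr scalerA mulrA.
have Esum m (f : 'I_m -> H) : E (\sum_i f i) = \sum_i E (f i).
  exact: (big_morph E (linear_opD Elin) (linear_op0 Elin)).
have Espan y : spanned v y -> spanned (E \o v) (E y).
  move=> [c ->]; exists c; rewrite Esum; apply: eq_bigr => i _.
  by rewrite linear_opZ.
have [d wE] : spanned v w.
  have [x _ <-] : range (T \o idfun) w.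
    by apply: wF; exists idfun; split=> //; [exact: nest1|exists x1].
  exact: Tv.
have [j dj] : exists j, d j != 0.
  apply: contrapT => h; move/eqP: w0; apply; rewrite wE big1// => i _.
  have [->|di] := eqVneq (d i) 0; first by rewrite scale0r.
  by case: h; exists i.
have dE : \sum_i d i *: (E \o v) i = 0.
  have -> : \sum_i d i *: (E \o v) i = E (\sum_i d i *: v i).
    by rewrite Esum; apply: eq_bigr => i _; rewrite linear_opZ.
  by rewrite -wE.
pose k := - (inner w w)^-1.
have T2E x : (T + k *: rank_one u w) x = E (T x).
  rewrite !fctE /E /rank_one uE scalerA /k mulNr scaleNr.
  by rewrite [_^-1 * _]mulrC.
have LT2 : L (T + k *: rank_one u w).
  apply: (IH (E \o v \o lift j)).
  - by apply: bounded_addZ => //; exact: bounded_rank_one.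
  - by move=> x; rewrite T2E; apply: (spanned_drop dj dE); exact: Espan.
  - move=> P x NP; have prP := nest_proj Nc (lie_hom_nest P).
    have [Tx|Tx] := pselect (T (P x) = 0).
      by rewrite T2E Tx (linear_op0 Elin) proj0.
    have [y _ /= wy] : range (T \o P) w by apply: wF; exists P; split=> //; exists x.
    have Pw : phi P w = w by rewrite -wy TU.
    by rewrite T2E /E projB// projZ// Pw TU.
have -> : T = (T + k *: rank_one u w) + (- k) *: rank_one u w.
  by rewrite -addrA -scalerDl subrr scale0r addr0.
exact: LD (LZ _ _ Luw).
Qed.
End Lie.

End LieIdealsOfNestAlgebras.

Theorem theorem4p3 (R : realType) (H : hilbertType R) (N L : set (H -> H))
    (N_continuous : continuous_nest N)
    (L_lie : lie_ideal N L) (L_closed : norm_closed L) :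
  left_order_continuous_hom N (lie_hom N L) /\
  forall T : H -> H, nest_algebra N T -> finite_rank T ->
    (L T <-> forall P, N P -> perp (lie_hom N L P) \o T \o P = 0).
Proof.
split; first exact: lie_hom_left_continuous.
move=> T [Tb _] Tfin; split=> [LT P NP|TU].
  by apply/funext => x /=; apply/perp_comp_eq0; apply: (lie_finite_rank_sub (N := N)).
have [n [v Tv]] := Tfin; apply: (lie_finite_rank_mem (N := N) _ _ _ _ Tv) => // P x NP.
by apply/perp_comp_eq0; have /(congr1 (fun f => f x)) := TU P NP.
Qed.
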